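(* Let $P$ be a fixed $(m_1,t_1)$-subspace of $R^{n+k}$ and let ${\cal M}'_R(m_1,t_1;m,t;n+k,n)$ be the set of all $(m,t)$-subspaces of $R^{n+k}$ containing $P$. Then this set is non-empty if and only if $$0\leq t_1\leq t\leq k\quad\text{and}\quad 0\leq m_1-t_1\leq m-t\leq n.$$ Moreover, if it is non-empty, its size $N'_R(m_1,t_1;m,t;n+k,n)$ does not depend on the choice of $P$ and $$N'_R(m_1,t_1;m,t;n+k,n)=|R|^{(k-t)(m-t-m_1+t_1)}N_R(m-t-m_1+t_1,n-m_1+t_1)N_R(t-t_1,k-t_1),$$ where $N_R(a,b)=\prod_{j=1}^{\ell}\prod_{i=0}^{a-1}\frac{|R_j|^{b-i}-|M_j|^{b-i}}{|R_j|^{a-i}-|M_j|^{a-i}}$ is the number of $a$-subspaces of $R^b$.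
   Context: $R$ is a finite commutative ring with identity $1\neq 0$, written as a direct product $R=R_1\times\cdots\times R_\ell$ of finite local rings $R_j$ with maximal ideals $M_j$. $R^{N}$ denotes row vectors of length $N$ over $R$. A set $\{\alpha_1,\dots,\alpha_m\}\subseteq R^N$ is unimodular if the matrix with rows $\alpha_i$ has a right inverse. An $m$-subspace of $R^N$ is an $R$-submodule having a basis of $m$ vectors forming a unimodular set; the $0$-subspace is $\{0\}$. Let $e_i$ be the $i$-th standard unit row vector of $R^{n+k}$ and $E=\langle e_{n+1},\dots,e_{n+k}\rangle$. An $m$-subspace $P$ of $R^{n+k}$ is an $(m,t)$-subspace if $P\cap E$ is a $t$-subspace. *)

(* Defs.v *)
From HB Require Import structures.
From mathcomp Require Import all_boot all_order all_algebra.
Set Implicit Arguments.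
Unset Strict Implicit.
Unset Printing Implicit Defensive.
Import GRing.Theory Num.Theory.
Local Open Scope ring_scope.

(* The library predicate [idealr_closed] includes properness (1 \notin I). *)
Definition maximal_ideal (A : finComNzRingType) (I : {set A}) : Prop :=
  idealr_closed I /\
  forall J : {set A}, idealr_closed J -> I \subset J -> J = I.

Definition local_ring_with (A : finComNzRingType) (M : {set A}) : Prop :=
  maximal_ideal M /\ forall I : {set A}, maximal_ideal I -> I = M.

(* Bijectivity of r |-> (pr_0 r, ..., pr_(l-1) r); since the pr_j are ring
   morphisms, it says that R is the direct product of the Rj. *)
Definition is_direct_product (R : finComNzRingType) (l : nat)
    (Rj : 'I_l -> finComNzRingType) (pr : forall j, {rmorphism R -> Rj j}) :
    Prop :=
  forall x : (forall j, Rj j), exists! r : R, forall j, pr j r = x j.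

Section Subspaces.
Variable R : finComNzRingType.

Definition unimodular (m N : nat) (A : 'M[R]_(m, N)) : bool :=
  [exists B : 'M[R]_(N, m), A *m B == 1%:M].

(* c *m A is the linear combination of the rows of A with coefficients c. *)
Definition row_span (m N : nat) (A : 'M[R]_(m, N)) : {set 'rV[R]_N} :=
  [set c *m A | c : 'rV[R]_m].

Definition row_indep (m N : nat) (A : 'M[R]_(m, N)) : bool :=
  [forall c : 'rV[R]_m, (c *m A == 0) ==> (c == 0)].

Definition submodule (N : nat) (P : {set 'rV[R]_N}) : bool :=
  (0 \in P) &&
  [forall a : R, forall u in P, forall v in P, a *: u + v \in P].

Lemma submoduleP (N : nat) (P : {set 'rV[R]_N}) :
  reflect (submod_closed P) (submodule P).
Proof.
apply: (iffP andP) => -[P0 H]; split=> //.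
  move=> a u v Pu Pv; move/forallP/(_ a)/forall_inP/(_ u Pu): H.
  by move/forall_inP; apply.
by apply/forallP=> a; apply/forall_inP=> u Pu; apply/forall_inP=> v; apply: H.
Qed.

Definition basis_of_rows (m N : nat) (P : {set 'rV[R]_N})
    (A : 'M[R]_(m, N)) : bool :=
  (P == row_span A) && row_indep A.

Definition subspace (N m : nat) (P : {set 'rV[R]_N}) : bool :=
  submodule P &&
  [exists A : 'M[R]_(m, N), basis_of_rows P A && unimodular A].

Definition Espace (n k : nat) : {set 'rV[R]_(n + k)} :=
  row_span (\matrix_(i < k) delta_mx 0 (rshift n i)).

Definition mt_subspace (n k m t : nat) (P : {set 'rV[R]_(n + k)}) : bool :=
  subspace m P && subspace t (P :&: Espace n k).

Definition mt_subspaces_above (n k m t : nat) (P : {set 'rV[R]_(n + k)}) :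
    {set {set 'rV[R]_(n + k)}} :=
  [set Q | mt_subspace m t Q & P \subset Q].

End Subspaces.

(* N_R(a, b). If b < a the factor i = b of the numerator vanishes, so the
   truncation of b - i for i > b is harmless. *)
Definition NR (l : nat) (Rj : 'I_l -> finComNzRingType)
    (M : forall j, {set Rj j}) (a b : nat) : rat :=
  \prod_(j < l) \prod_(i < a)
    ((#|Rj j|%:R ^+ (b - i) - #|M j|%:R ^+ (b - i)) /
     (#|Rj j|%:R ^+ (a - i) - #|M j|%:R ^+ (a - i))).

(* Main.v *)
Require Import Defs.
From HB Require Import structures.
From mathcomp Require Import all_boot all_order all_algebra.
From mathcomp Require Import ring zify.
Set Implicit Arguments.
Unset Strict Implicit.
Unset Printing Implicit Defensive.
Import GRing.Theory Num.Theory.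
Local Open Scope ring_scope.

(* A submodule [Q] of [R^(n + k)] is an (m, t)-subspace iff its projection to [R^n], which is
   [Q / (Q :&: E)], is an (m - t)-subspace and its slice [Q :&: E], read inside [R^k], is a
   t-subspace: choosing bases of both and lifting the first gives a block-triangular basis of
   [Q]. Hence the (m, t)-subspaces above [P] are counted by choosing a projection and a slice
   above those of [P], which gives the two factors [NR]; the submodules above [P] with a given
   projection and slice correspond to the matrices lifting the new basis vectors of the
   projection modulo the slice, which gives the power of [#|R|].

   Linear algebra over [R] works as over a field because linearly independent rows are
   unimodular and complete to an invertible matrix: every [x] satisfies
   [x ^+ N = x ^+ N.+1 * a] for some [N] and [a], so a row without annihilator is unimodular and
   [R] has stable range 1. The number of a-subspaces is thus a quotient of two numbers of
   matrices with independent rows; these are multiplicative in [R] and reduce over a local ring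
   to counting the rows with an entry outside the maximal ideal. *)

Lemma card_constant_fibres (T U : finType) (f : T -> U) (A : {set T}) (B : {set U}) (c : nat) :
  {in A, forall x, f x \in B} -> {in B, forall y, #|[set x in A | f x == y]| = c} ->
  #|A| = (#|B| * c)%N.
Proof.
move=> fAB fibre; rewrite -sum1_card (partition_big f (mem B)) //= -sum_nat_const.
by apply: eq_bigr => y /fibre <-; rewrite sum1dep_card.
Qed.

Lemma pid_mx_ublock (R : pzSemiRingType) (r m n p : nat) :
  block_mx 1%:M 0 0 (pid_mx r) = pid_mx (p + r) :> 'M[R]_(p + m, p + n).
Proof.
apply/matrixP => i j; rewrite !mxE; case: splitP => i' ->; rewrite !mxE; case: splitP => j' ->.
- by rewrite mxE -val_eqE /= ltn_addr // andbT.
- by rewrite mxE ltn_eqF // ltn_addr.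
- by rewrite mxE gtn_eqF // ltn_addr.
- by rewrite mxE eqn_add2l ltn_add2l.
Qed.

Section Unimodular.
Variable R : finComNzRingType.

Lemma unimodularP (m n : nat) (A : 'M[R]_(m, n)) :
  reflect (exists B, A *m B = 1%:M) (unimodular A).
Proof. by apply: (iffP existsP) => -[B AB]; exists B; apply/eqP. Qed.

Lemma unimodular1 (n : nat) : unimodular (1%:M : 'M[R]_n).
Proof. by apply/unimodularP; exists 1%:M; rewrite mul1mx. Qed.

Lemma unimodular_mulmx (m n p : nat) (A : 'M[R]_(m, n)) (B : 'M[R]_(n, p)) :
  unimodular A -> unimodular B -> unimodular (A *m B).
Proof.
move=> /unimodularP[A' AA'] /unimodularP[B' BB']; apply/unimodularP; exists (B' *m A').
by rewrite mulmxA -[A *m B *m B']mulmxA BB' mulmx1.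
Qed.

Lemma unimodular_ublock (m n p q : nat) (A : 'M[R]_(m, n)) (B : 'M[R]_(m, q))
    (C : 'M[R]_(p, q)) :
  unimodular A -> unimodular C -> unimodular (block_mx A B 0 C).
Proof.
move=> /unimodularP[A' AA'] /unimodularP[C' CC']; apply/unimodularP.
exists (block_mx A' (- (A' *m (B *m C'))) 0 C').
rewrite mulmx_block !mul0mx !mulmx0 addr0 !add0r mulmxN (mulmxA A) AA' mul1mx addNr CC'.
by rewrite -scalar_mx_block.
Qed.

Lemma unimodular_lblock (m n p q : nat) (A : 'M[R]_(m, n)) (B : 'M[R]_(p, n))
    (C : 'M[R]_(p, q)) :
  unimodular A -> unimodular C -> unimodular (block_mx A 0 B C).
Proof.
move=> /unimodularP[A' AA'] /unimodularP[C' CC']; apply/unimodularP.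
exists (block_mx A' 0 (- (C' *m (B *m A'))) C').
rewrite mulmx_block !mul0mx !mulmx0 !addr0 add0r mulmxN (mulmxA C) CC' mul1mx subrr AA'.
by rewrite -scalar_mx_block.
Qed.

Lemma row_indepP (m n : nat) (A : 'M[R]_(m, n)) :
  reflect (forall c : 'rV_m, c *m A = 0 -> c = 0) (row_indep A).
Proof.
apply: (iffP forallP) => [A_ind c cA | A_ind c].
  by have := A_ind c; rewrite cA eqxx => /eqP.
by apply/implyP => /eqP/A_ind->.
Qed.

Lemma unimodular_row_indep (m n : nat) (A : 'M[R]_(m, n)) : unimodular A -> row_indep A.
Proof.
by case/unimodularP => B AB; apply/row_indepP=> c cA; rewrite -[c]mulmx1 -AB mulmxA cA mul0mx.
Qed.

Lemma row_indep_pid_mx (m n : nat) : (m <= n)%N -> row_indep (pid_mx m : 'M[R]_(m, n)).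
Proof.
move=> le_mn; apply/unimodular_row_indep/unimodularP; exists (pid_mx m).
by rewrite pid_mx_id // pid_mx_1.
Qed.

Lemma row_indep_mulmx (m n p : nat) (A : 'M[R]_(m, n)) (C : 'M[R]_(p, m)) :
  row_indep A -> row_indep (C *m A) = row_indep C.
Proof.
move=> /row_indepP A_ind; apply/row_indepP/row_indepP => C_ind c cC.
  by apply: C_ind; rewrite mulmxA cC mul0mx.
by apply/C_ind/A_ind; rewrite -mulmxA.
Qed.

Lemma row_indep_mulmx_inj (m n p : nat) (A : 'M[R]_(m, n)) :
  row_indep A -> injective (fun C : 'M[R]_(p, m) => C *m A).
Proof.
move=> /row_indepP A_ind C D /= CD; apply/row_matrixP => i; apply/eqP.
rewrite -subr_eq0 -raddfB; apply/eqP/A_ind.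
by rewrite -row_mul mulmxBl CD subrr row0.
Qed.

Lemma row_indep_usubmx (m1 m2 n : nat) (A : 'M[R]_(m1 + m2, n)) :
  row_indep A -> row_indep (usubmx A).
Proof.
move=> /row_indepP A_ind; apply/row_indepP => c cA.
have /eqP : row_mx c 0 = 0 :> 'rV_(m1 + m2).
  by apply: A_ind; rewrite -[A]vsubmxK mul_row_col cA mul0mx addr0.
by rewrite row_mx_eq0 => /andP[/eqP].
Qed.

Lemma row_indep_lblock1 (a m n : nat) (B : 'M[R]_(m, a)) (C : 'M[R]_(m, n)) :
  row_indep (block_mx 1%:M 0 B C) = row_indep C.
Proof.
apply/row_indepP/row_indepP => C_ind c.
  move=> cC; have /eqP : row_mx (- (c *m B)) c = 0.
    by apply: C_ind; rewrite mul_row_block mulmx1 mulmx0 addNr add0r cC row_mx0.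
  by rewrite row_mx_eq0 => /andP[_ /eqP].
rewrite -[c]hsubmxK mul_row_block mulmx1 mulmx0 add0r => /eqP.
rewrite row_mx_eq0 => /andP[cB /eqP/C_ind c0].
by move: cB; rewrite c0 mul0mx addr0 => /eqP ->; rewrite row_mx0.
Qed.

Lemma row_indep_row_mx0 (m n k : nat) (A : 'M[R]_(m, k)) :
  row_indep (row_mx (0 : 'M_(m, n)) A) = row_indep A.
Proof.
apply/row_indepP/row_indepP => A_ind c cA; apply: A_ind.
  by rewrite mul_mx_row mulmx0 cA row_mx0.
by move: cA; rewrite mul_mx_row => /eqP; rewrite row_mx_eq0 => /andP[_ /eqP].
Qed.

Lemma row_indep_leq (m n : nat) (A : 'M[R]_(m, n)) : row_indep A -> (m <= n)%N.
Proof.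
move=> A_ind; have := leq_card _ (@row_indep_mulmx_inj m n 1 A A_ind).
by rewrite !card_mx !mul1n leq_exp2l // card_finNzRing_gt1.
Qed.

Lemma row_indep_flatmx (n : nat) (A : 'M[R]_(0, n)) : row_indep A.
Proof. by apply/row_indepP => c _; apply: thinmx0. Qed.

End Unimodular.

Section FiniteRing.
Variable R : finComNzRingType.

Lemma expr_stationary (x : R) : exists N a, x ^+ N = x ^+ N.+1 * a.
Proof.
have /injectivePn[i [j ij xij]] : ~~ injectiveb (fun i : 'I_#|R|.+1 => x ^+ i).
  by apply/negP => /injectiveP/leq_card; rewrite card_ord ltnn.
wlog lt_ij : i j ij xij / (i < j)%N.
  have := ij; rewrite neq_ltn => /orP[|lt_ji wl]; first by move=> ? /(_ i j); apply.
  by apply: (wl j i) => //; rewrite eq_sym.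
by exists i, (x ^+ (j - i.+1)); rewrite -exprD subnKC.
Qed.

(* If [x ^+ N = x ^+ N.+1 * a], then [z = 1 - x * a] works: [x] is invertible
   where [z] vanishes and nilpotent on the multiples of [z]. *)
Lemma stable_range1 (x y p q : R) :
  x * p + y * q = 1 -> exists z u, (x + y * z) * u = 1.
Proof.
move=> xy; have [N [a xN]] := expr_stationary x; exists (1 - x * a).
set w := x + _; have w_reg : GRing.lreg w.
  apply: mulrI0_lreg => r wr.
  have xNr : x ^+ N * r = 0.
    rewrite xN exprSr; transitivity (a * x ^+ N * (w * r) - a * y * (x ^+ N - x ^+ N.+1 * a) * r).
      by rewrite /w exprSr; ring.
    by rewrite -xN subrr wr; ring.
  have rE : r = (p - q * (1 - y * a)) * (x * r).
    rewrite -[LHS]mul1r -[X in X * r]xy -[RHS]add0r -(mulr0 q) -wr /w; ring.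
  elim: N xNr {xN} => [|M IHM]; first by rewrite mul1r.
  by move=> xr; apply: IHM; rewrite rE mulrCA (mulrA (x ^+ M)) -exprSr xr mulr0.
by have /codomP[u wu] := injF_onto w_reg 1; exists u.
Qed.

(* The factor [r] carries the induction on [n]: the remaining entries only have to fix
   [(1 - x * a) * r], and the first entry [x] is nilpotent on the multiples of that element. *)
Lemma faithful_row_fix (n : nat) (v : 'rV[R]_n) (r : R) :
  (forall c, (c * r) *: v = 0 -> c * r = 0) -> exists b : 'cV_n, (v *m b) 0 0 * r = r.
Proof.
elim: n v r => [|n IHn] v r v_faithful.
  by exists 0; rewrite -[r]mul1r (v_faithful 1) ?mulr0 //; apply: thinmx0.
rewrite -[v](@hsubmxK _ 1 1 n) in v_faithful *.
move: (@lsubmx _ 1 1 n v) (@rsubmx _ 1 1 n v) v_faithful => y w.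
rewrite [y]mx11_scalar; move: (y 0 0) => {v y}x v_faithful.
have {}v_faithful c : x * (c * r) = 0 -> (c * r) *: w = 0 -> c * r = 0.
  move=> xcr cw; suff: (c * r) *: row_mx x%:M w = 0 by apply: v_faithful.
  by rewrite scale_row_mx scale_scalar_mx mulrC xcr cw raddf0 row_mx0.
have [N [a xN]] := expr_stationary x; set f := 1 - x * a.
have [c cw | b bf] := IHn w (f * r).
  have /(_ N) x_nil M : x ^+ M * (c * (f * r)) = 0 -> c * (f * r) = 0.
    elim: M => [|M IHM]; first by rewrite mul1r.
    rewrite exprS -mulrA => xcr; apply: IHM.
    rewrite !mulrA; apply: v_faithful; rewrite -!mulrA //.
    by rewrite -scalerA cw scaler0.
  apply: x_nil; transitivity ((x ^+ N - x ^+ N.+1 * a) * c * r); first by rewrite /f exprSr; ring.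
  by rewrite -xN subrr !mul0r.
exists (col_mx a%:M (f *: b)).
have -> : row_mx x%:M w *m col_mx a%:M (f *: b) = (x * a)%:M + f *: (w *m b).
  by rewrite mul_row_col -scalar_mxM -scalemxAr.
rewrite 3!mxE mulr1n; transitivity (x * a * r + (w *m b) 0 0 * (f * r)); first by ring.
by rewrite bf /f; ring.
Qed.

Lemma row_indep_unimodular_row (n : nat) (v : 'rV[R]_n) : row_indep v -> unimodular v.
Proof.
move=> /row_indepP v_ind; have [c | b] := @faithful_row_fix n v 1.
  rewrite mulr1 -mul_scalar_mx => /v_ind/matrixP/(_ 0 0).
  by rewrite !mxE.
rewrite mulr1 => vb; apply/unimodularP; exists b.
by rewrite [v *m b]mx11_scalar vb.
Qed.

Lemma row_indep_row_reduce (n : nat) (v : 'rV[R]_(1 + n)) : row_indep v ->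
  exists2 G : 'M_(1 + n), unimodular G & v *m G = row_mx 1%:M 0.
Proof.
rewrite -[v]hsubmxK; move: (lsubmx v) (rsubmx v) => x w.
rewrite [x]mx11_scalar; move: (x 0 0) => {v}x /row_indep_unimodular_row/unimodularP[b].
rewrite -[b]vsubmxK mul_row_col; move: (usubmx b) (dsubmx b) => {}b d.
move=> /matrixP/(_ 0 0); rewrite mul_scalar_mx [LHS]mxE [X in X + _]mxE [RHS]mxE => bd.
have [z [u yu]] : exists z u, (x + (w *m d) 0 0 * z) * u = 1.
  by apply: (@stable_range1 x _ (b 0 0) 1); rewrite mulr1.
set y := (_ + _) in yu; pose U := block_mx u%:M (- (u%:M *m w)) 0 (1%:M : 'M_n).
exists (block_mx 1%:M 0 (z *: d) 1%:M *m U).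
  apply: unimodular_mulmx; first by apply: unimodular_lblock; apply: unimodular1.
  apply: unimodular_ublock; last exact: unimodular1.
  by apply/unimodularP; exists y%:M; rewrite -scalar_mxM mulrC yu.
have yE : x%:M + w *m (z *: d) = y%:M.
  by rewrite [w *m _]mx11_scalar -scalemxAr [X in _ + X%:M]mxE mulrC -raddfD.
rewrite mulmxA !mul_row_block !mulmx1 !mulmx0 addr0 add0r yE mulmxN mulmxA.
by rewrite -scalar_mxM yu mul1mx addNr.
Qed.

Lemma row_indep_normal_form (m n : nat) (A : 'M[R]_(m, n)) : row_indep A ->
  exists2 G : 'M_n, unimodular G & A *m G = pid_mx m.
Proof.
elim: m n A => [|m IHm] n A A_ind.
  by exists 1%:M; [apply: unimodular1 | rewrite [LHS]flatmx0 [RHS]flatmx0].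
case: n A A_ind => [|n]; first by move=> A /row_indep_leq.
rewrite -[m.+1]/(1 + m)%N -[n.+1]/(1 + n)%N => A A_ind.
have [G G_uni AG1] := row_indep_row_reduce (row_indep_usubmx A_ind).
have [c [A' AG]] : exists c A', A *m G = block_mx 1%:M 0 c A'.
  exists (lsubmx (dsubmx A *m G)), (rsubmx (dsubmx A *m G)).
  by rewrite block_mxEv -AG1 hsubmxK -mul_col_mx vsubmxK.
have A'_ind : row_indep A'.
  by rewrite -(row_indep_lblock1 c) -AG row_indep_mulmx // unimodular_row_indep.
have [G' G'_uni AG'] := IHm n A' A'_ind.
pose K : 'M_(n, m) := G' *m pid_mx m.
have A'K : A' *m K = 1%:M.
  by rewrite mulmxA AG' pid_mx_id ?pid_mx_1 // (row_indep_leq A'_ind).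
exists (G *m block_mx 1%:M 0 (- (K *m c)) G').
  by apply: unimodular_mulmx G_uni (unimodular_lblock _ _ G'_uni); apply: unimodular1.
rewrite mulmxA [A *m G]AG mulmx_block !mul0mx !mulmx0 !mulmx1 !addr0 add0r.
by rewrite mulmxN mulmxA A'K AG' mul1mx subrr pid_mx_ublock.
Qed.

Lemma row_indep_unimodular (m n : nat) (A : 'M[R]_(m, n)) : row_indep A = unimodular A.
Proof.
apply/idP/idP; last exact: unimodular_row_indep.
move=> A_ind; have [G _ AG] := row_indep_normal_form A_ind.
apply/unimodularP; exists (G *m pid_mx m).
by rewrite mulmxA AG pid_mx_id ?pid_mx_1 // (row_indep_leq A_ind).
Qed.

Lemma row_indep_ublock (m n p q : nat) (A : 'M[R]_(m, n)) (B : 'M[R]_(m, q)) (C : 'M[R]_(p, q)) :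
  row_indep A -> row_indep C -> row_indep (block_mx A B 0 C).
Proof. by rewrite !row_indep_unimodular; apply: unimodular_ublock. Qed.

Lemma row_indep_complete (m r : nat) (A : 'M[R]_(m, m + r)) : row_indep A ->
  exists D : 'M[R]_(r, m + r), row_indep (col_mx A D).
Proof.
move=> A_ind; have [G /unimodularP[H GH] AG] := row_indep_normal_form A_ind.
exists (dsubmx H); suff -> : A = usubmx H.
  by rewrite vsubmxK; apply/unimodular_row_indep/unimodularP; exists G; apply: mulmx1C.
rewrite -[H]mul1mx -mul_usub_mx scalar_mx_block block_mxEv col_mxKu -pid_mx_row -AG.
by rewrite -mulmxA GH mulmx1.
Qed.

End FiniteRing.

Section CountIndependent.
Variable R : finComNzRingType.

Definition num_indep (m n : nat) : nat := #|[set A : 'M[R]_(m, n) | row_indep A]|.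

Lemma num_indep_gt0 (m n : nat) : (0 < num_indep m n)%N = (m <= n)%N.
Proof.
apply/card_gt0P/idP => [[A] | le_mn]; first by rewrite inE => /row_indep_leq.
by exists (pid_mx m); rewrite inE row_indep_pid_mx.
Qed.

Lemma card_row_indep_extend (m p n : nat) (A : 'M[R]_(m, n)) : row_indep A ->
  #|[set D : 'M[R]_(p, n) | row_indep (col_mx A D)]| = (#|R| ^ (p * m) * num_indep p (n - m))%N.
Proof.
move=> A_ind; have := subnKC (row_indep_leq A_ind).
move: (n - m)%N => r nE; move: A A_ind; rewrite -{n}nE => A A_ind.
have [G G_uni AG] := row_indep_normal_form A_ind.
rewrite pid_mx_row in AG; have /unimodularP[H GH] := G_uni.
pose g (D : 'M[R]_(p, m + r)) := (lsubmx (D *m G), rsubmx (D *m G)).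
have g_bij : bijective g.
  exists (fun Y => row_mx Y.1 Y.2 *m H) => [D | [B C]]; rewrite /g /=.
    by rewrite hsubmxK -mulmxA GH mulmx1.
  by rewrite -mulmxA (mulmx1C GH) mulmx1 row_mxKl row_mxKr.
have -> : [set D : 'M[R]_(p, m + r) | row_indep (col_mx A D)] =
    g @^-1: setX setT [set C | row_indep C].
  apply/setP => D; rewrite !inE /= -(row_indep_mulmx _ (unimodular_row_indep G_uni)).
  by rewrite mul_col_mx AG -[D *m G]hsubmxK -block_mxEv row_indep_lblock1 hsubmxK.
by rewrite (on_card_preimset (onW_bij _ g_bij)) cardsX cardsT card_mx.
Qed.

Lemma num_indepD (m p n : nat) :
  num_indep (m + p) n = (num_indep m n * (#|R| ^ (p * m) * num_indep p (n - m)))%N.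
Proof.
apply: (card_constant_fibres (f := usubmx)) => A; rewrite !inE; first exact: row_indep_usubmx.
move=> A_ind; rewrite -(card_row_indep_extend p A_ind).
have col_inj : injective (@col_mx R m p n A) by move=> B C /eq_col_mx[].
rewrite -(card_imset _ col_inj); apply: eq_card => D; rewrite !inE.
apply/andP/imsetP => [[D_ind /eqP <-] | [C]]; last by rewrite inE => C_ind ->; rewrite col_mxKu.
by exists (dsubmx D); rewrite ?inE vsubmxK.
Qed.

Lemma num_indepE (m n : nat) :
  num_indep m n = (\prod_(i < m) (#|R| ^ i * num_indep 1 (n - i)))%N.
Proof.
elim: m => [|m IHm]; last by rewrite big_ord_recr /= -IHm -addn1 num_indepD mul1n.
rewrite big_ord0 -(cards1 (0 : 'M[R]_(0, n))); apply: eq_card => A.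
by rewrite !inE row_indep_flatmx [A]flatmx0 eqxx.
Qed.

End CountIndependent.

Section RowSpan.
Variable R : finComNzRingType.

Lemma row_spanP (m n : nat) (A : 'M[R]_(m, n)) (v : 'rV[R]_n) :
  reflect (exists c, v = c *m A) (v \in row_span A).
Proof. by apply: (iffP imsetP) => [[c _ ->] | [c ->]]; exists c. Qed.

Lemma submodule_row_span (m n : nat) (A : 'M[R]_(m, n)) : submodule (row_span A).
Proof.
apply/submoduleP; split=> [|a _ _ /row_spanP[c ->] /row_spanP[d ->]]; apply/row_spanP.
  by exists 0; rewrite mul0mx.
by exists (a *: c + d); rewrite scalemxAl mulmxDl.
Qed.

Lemma row_in_row_span (m n : nat) (A : 'M[R]_(m, n)) (i : 'I_m) : row i A \in row_span A.
Proof. by apply/row_spanP; exists (delta_mx 0 i); rewrite rowE. Qed.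

Lemma row_span_subP (m n : nat) (A : 'M[R]_(m, n)) (Q : {set 'rV[R]_n}) : submodule Q ->
  reflect (forall i, row i A \in Q) (row_span A \subset Q).
Proof.
case/submoduleP=> Q0 QD; apply: (iffP subsetP) => [sAQ i | AQ _ /row_spanP[c ->]].
  exact/sAQ/row_in_row_span.
rewrite mulmx_sum_row; apply: (big_ind (fun v => v \in Q)) => // [u v Qu Qv | i _].
  by rewrite -[u]scale1r QD.
by rewrite -[_ *: _]addr0 QD.
Qed.

Lemma row_span_mulmxP (m p n : nat) (A : 'M[R]_(m, n)) (B : 'M[R]_(p, n)) :
  reflect (exists C, B = C *m A) (row_span B \subset row_span A).
Proof.
apply: (iffP (row_span_subP B (submodule_row_span A))) => [sBA | [C ->] i]; last first.
  by rewrite row_mul; apply/row_spanP; exists (row i C).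
have [f fE] := fin_all_exists (fun i => row_spanP _ _ (sBA i)).
by exists (\matrix_i f i); apply/row_matrixP => i; rewrite row_mul rowK.
Qed.

Lemma row_span_col_mx_sub (m p n : nat) (A : 'M[R]_(m, n)) (B : 'M[R]_(p, n))
    (Q : {set 'rV[R]_n}) : submodule Q ->
  (row_span (col_mx A B) \subset Q) = (row_span A \subset Q) && (row_span B \subset Q).
Proof.
move=> Q_sub; apply/(row_span_subP _ Q_sub)/andP => [ABQ | [AQ BQ] i].
  split; apply/(row_span_subP _ Q_sub) => i.
    by rewrite -(col_mxKu A B) row_usubmx.
  by rewrite -(col_mxKd A B) row_dsubmx.
rewrite -[i]splitK; case: (split i) => i' /=.
  by rewrite -row_usubmx col_mxKu; apply: row_span_subP AQ _.
by rewrite -row_dsubmx col_mxKd; apply: row_span_subP BQ _.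
Qed.

Lemma row_span_col_mxC (m p n : nat) (A : 'M[R]_(m, n)) (B : 'M[R]_(p, n)) :
  row_span (col_mx A B) = row_span (col_mx B A).
Proof.
apply/setP => v; apply/row_spanP/row_spanP => -[c ->]; exists (row_mx (rsubmx c) (lsubmx c));
  by rewrite -{1}[c]hsubmxK !mul_row_col addrC.
Qed.

Lemma row_span_sub_col_mxl (m p n : nat) (A : 'M[R]_(m, n)) (B : 'M[R]_(p, n)) :
  row_span A \subset row_span (col_mx A B).
Proof.
have := subxx (row_span (col_mx A B)).
by rewrite row_span_col_mx_sub ?submodule_row_span // => /andP[].
Qed.

Lemma row_span_sub_col_mxr (m p n : nat) (A : 'M[R]_(m, n)) (B : 'M[R]_(p, n)) :
  row_span B \subset row_span (col_mx A B).
Proof. by rewrite row_span_col_mxC row_span_sub_col_mxl. Qed.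

Lemma row_span_col_mx0 (m p n : nat) (A : 'M[R]_(m, n)) :
  row_span (col_mx A (0 : 'M_(p, n))) = row_span A.
Proof.
apply/setP => v; apply/row_spanP/row_spanP => -[c ->].
  by exists (lsubmx c); rewrite -{1}[c]hsubmxK mul_row_col mulmx0 addr0.
by exists (row_mx c 0); rewrite mul_row_col mul0mx addr0.
Qed.

Lemma card_row_span (m n : nat) (A : 'M[R]_(m, n)) :
  row_indep A -> #|row_span A| = (#|R| ^ m)%N.
Proof. by move=> A_ind; rewrite card_imset ?card_mx ?mul1n //; apply: row_indep_mulmx_inj. Qed.

Lemma subspaceP (m n : nat) (P : {set 'rV[R]_n}) :
  reflect (exists2 A : 'M[R]_(m, n), row_indep A & P = row_span A) (subspace m P).
Proof.
apply: (iffP andP) => [[_ /existsP[A]] | [A A_ind ->]].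
  by case/andP => /andP[/eqP -> A_ind] _; exists A.
split; first exact: submodule_row_span.
by apply/existsP; exists A; rewrite /basis_of_rows eqxx A_ind -row_indep_unimodular.
Qed.

Lemma subspace_row_span (m n : nat) (A : 'M[R]_(m, n)) : row_indep A -> subspace m (row_span A).
Proof. by move=> A_ind; apply/subspaceP; exists A. Qed.

Lemma subspaceT (n : nat) : subspace n [set: 'rV[R]_n].
Proof.
apply/subspaceP; exists 1%:M; first exact/unimodular_row_indep/unimodular1.
by apply/setP => v; rewrite inE; apply/esym/row_spanP; exists v; rewrite mulmx1.
Qed.

Lemma card_subspace (m n : nat) (P : {set 'rV[R]_n}) : subspace m P -> #|P| = (#|R| ^ m)%N.
Proof. by case/subspaceP => A A_ind ->; apply: card_row_span. Qed.

Lemma subspace_leq (m p n : nat) (P Q : {set 'rV[R]_n}) :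
  subspace m P -> subspace p Q -> P \subset Q -> (m <= p)%N.
Proof.
move=> /card_subspace cardP /card_subspace cardQ /subset_leq_card.
by rewrite cardP cardQ leq_exp2l // card_finNzRing_gt1.
Qed.

Lemma subspace_leq_dim (m n : nat) (P : {set 'rV[R]_n}) : subspace m P -> (m <= n)%N.
Proof. by case/subspaceP => A /row_indep_leq. Qed.

Lemma subspace_eq (m n : nat) (P Q : {set 'rV[R]_n}) :
  subspace m P -> subspace m Q -> P \subset Q -> P = Q.
Proof.
move=> /card_subspace cardP /card_subspace cardQ sPQ.
by apply/eqP; rewrite eqEcard sPQ cardP cardQ leqnn.
Qed.

Lemma basis_extend (m p n : nat) (A : 'M[R]_(m, n)) (Q : {set 'rV[R]_n}) :
  row_indep A -> subspace (m + p) Q -> row_span A \subset Q ->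
  exists2 D : 'M[R]_(p, n), row_indep (col_mx A D) & Q = row_span (col_mx A D).
Proof.
move=> A_ind Q_sub; have /subspaceP[B B_ind QB] := Q_sub.
rewrite {1}QB => /row_span_mulmxP[C AE].
have C_ind : row_indep C by rewrite -(row_indep_mulmx C B_ind) -AE.
have [D CD_ind] := row_indep_complete C_ind.
have ADE : col_mx A (D *m B) = col_mx C D *m B by rewrite mul_col_mx -AE.
have AD_ind : row_indep (col_mx A (D *m B)) by rewrite ADE row_indep_mulmx.
exists (D *m B) => //; apply/esym/(subspace_eq (subspace_row_span AD_ind) Q_sub).
by rewrite QB; apply/row_span_mulmxP; exists (col_mx C D).
Qed.

Definition subspaces_above (m n : nat) (P : {set 'rV[R]_n}) : {set {set 'rV[R]_n}} :=
  [set Q | subspace m Q & P \subset Q].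

(* The bases of a given [Q] extending [A] are the products [C *m B], where [B] is one of them and
   [C] ranges over the extensions of [row_mx 1%:M 0] to an invertible matrix. *)
Lemma card_basis_extensions (m p n : nat) (A : 'M[R]_(m, n)) (Q : {set 'rV[R]_n}) :
  row_indep A -> Q \in subspaces_above (m + p) (row_span A) ->
  #|[set D : 'M[R]_(p, n) | row_indep (col_mx A D) & row_span (col_mx A D) == Q]| =
  (#|R| ^ (p * m) * num_indep R p p)%N.
Proof.
move=> A_ind; rewrite inE => /andP[Q_sub /(basis_extend A_ind Q_sub)[D0]].
set B := col_mx A D0 => B_ind QE.
have id_ind : row_indep (row_mx 1%:M 0 : 'M[R]_(m, m + p)).
  by rewrite -pid_mx_row; apply/row_indep_pid_mx/leq_addr.
have AB : A = row_mx 1%:M 0 *m B by rewrite mul_row_col mul1mx mul0mx addr0.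
have := card_row_indep_extend p id_ind; rewrite addKn => <-.
rewrite -(card_imset _ (row_indep_mulmx_inj B_ind)); apply: eq_card => D; rewrite inE.
apply/andP/imsetP => [[AD_ind /eqP ADQ] | [C]]; last first.
  rewrite inE => C_ind ->; rewrite {1 2}AB -mul_col_mx row_indep_mulmx //; split=> //.
  apply/eqP/(subspace_eq _ Q_sub); first by apply: subspace_row_span; rewrite row_indep_mulmx.
  by rewrite QE; apply/row_span_mulmxP; exists (col_mx (row_mx 1%:M 0) C).
have : row_span D \subset Q by rewrite -ADQ row_span_sub_col_mxr.
rewrite QE => /row_span_mulmxP[C DE]; exists C => //.
by rewrite inE -(row_indep_mulmx _ B_ind) mul_col_mx -AB -DE.
Qed.

Lemma card_subspaces_above (m p n : nat) (P : {set 'rV[R]_n}) : subspace m P ->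
  (#|subspaces_above (m + p) P| * num_indep R p p)%N = num_indep R p (n - m).
Proof.
case/subspaceP => A A_ind ->; apply/eqP.
have R_gt0 : (0 < #|R| ^ (p * m))%N by rewrite expn_gt0 ltnW ?card_finNzRing_gt1.
rewrite -(eqn_pmul2l R_gt0) mulnCA -(card_row_indep_extend p A_ind); apply/eqP/esym.
apply: (card_constant_fibres (f := fun D => row_span (col_mx A D))) => [D | Q Q_above].
  by rewrite !inE => AD_ind; rewrite subspace_row_span // row_span_sub_col_mxl.
rewrite -(card_basis_extensions A_ind Q_above); apply: eq_card => D.
by rewrite !inE.
Qed.

Lemma subspaces_above_neq0 (m p n : nat) (P : {set 'rV[R]_n}) : subspace m P ->
  (subspaces_above p P != set0) = (m <= p <= n)%N.
Proof.
move=> P_sub; apply/idP/andP => [/set0Pn[Q] | [le_mp le_pn]].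
  rewrite inE => /andP[Q_sub sPQ].
  by rewrite (subspace_leq P_sub Q_sub sPQ) (subspace_leq_dim Q_sub).
have := num_indep_gt0 R (p - m) (n - m); rewrite leq_sub2r // -(card_subspaces_above _ P_sub).
by rewrite subnKC // muln_gt0 card_gt0 => /andP[].
Qed.

Lemma subspace0 (n : nat) : subspace 0 [set 0 : 'rV[R]_n].
Proof.
apply/subspaceP; exists 0; first exact: row_indep_flatmx.
by apply/setP => v; rewrite inE; apply/eqP/row_spanP => [-> | [c ->]];
  [exists 0; rewrite mul0mx | rewrite mulmx0].
Qed.

End RowSpan.

Section Slices.
Variables (R : finComNzRingType) (n k : nat).
Implicit Types (P Q : {set 'rV[R]_(n + k)}).

Definition lproj Q : {set 'rV[R]_n} := [set lsubmx v | v in Q].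

Definition rslice Q : {set 'rV[R]_k} := [set w | row_mx 0 w \in Q].

Lemma lprojS P Q : P \subset Q -> lproj P \subset lproj Q.
Proof. exact: imsetS. Qed.

Lemma rsliceS P Q : P \subset Q -> rslice P \subset rslice Q.
Proof. by move=> /subsetP sPQ; apply/subsetP => w; rewrite !inE; apply: sPQ. Qed.

Lemma lproj_row_span (m : nat) (A : 'M[R]_(m, n + k)) :
  lproj (row_span A) = row_span (lsubmx A).
Proof.
apply/setP => v; apply/imsetP/row_spanP => [[_ /row_spanP[c ->] ->] | [c ->]].
  by exists c; rewrite mulmx_lsub.
by exists (c *m A); [apply/row_spanP; exists c | rewrite mulmx_lsub].
Qed.

Lemma rslice_row_span (m : nat) (T : 'M[R]_(m, k)) Q :
  (row_span T \subset rslice Q) = (row_span (row_mx 0 T) \subset Q).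
Proof.
apply/subsetP/subsetP => sTQ _ /row_spanP[c ->].
  rewrite mul_mx_row mulmx0.
  by have: c *m T \in rslice Q; [apply/sTQ/row_spanP; exists c | rewrite inE].
rewrite inE -(mulmx0 _ c) -mul_mx_row; apply: sTQ.
by apply/row_spanP; exists c.
Qed.

Lemma mem_Espace (v : 'rV[R]_(n + k)) : (v \in Espace R n k) = (lsubmx v == 0).
Proof.
rewrite /Espace.
have -> : \matrix_(i < k) delta_mx 0 (rshift n i) = row_mx 0 1%:M :> 'M[R]_(k, n + k).
  by apply/row_matrixP => i; rewrite rowK row_row_mx row0 row1 delta_mx_rshift.
apply/row_spanP/eqP => [[c ->] | v0]; first by rewrite mul_mx_row row_mxKl mulmx0.
by exists (rsubmx v); rewrite mul_mx_row mulmx0 mulmx1 -v0 hsubmxK.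
Qed.

Lemma row_span_row_mx0 (m : nat) (T : 'M[R]_(m, k)) :
  row_span (row_mx (0 : 'M_(m, n)) T) = row_mx 0 @: row_span T.
Proof.
apply/setP => v; apply/row_spanP/imsetP => [[c ->] | [_ /row_spanP[c ->] ->]].
  by exists (c *m T); [apply/row_spanP; exists c | rewrite mul_mx_row mulmx0].
by exists c; rewrite mul_mx_row mulmx0.
Qed.

Lemma subspace_row_mx0 (t : nat) (W : {set 'rV[R]_k}) :
  subspace t (row_mx (0 : 'rV_n) @: W) = subspace t W.
Proof.
have row_mx0_inj : injective (row_mx (0 : 'rV[R]_n) : 'rV_k -> _) by move=> u v /eq_row_mx[].
apply/subspaceP/subspaceP => -[B B_ind BW]; last first.
  by exists (row_mx 0 B); rewrite ?row_indep_row_mx0 // BW row_span_row_mx0.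
have rowB i : exists w, row i B = row_mx 0 w.
  have /imsetP[w _ Bw] : row i B \in row_mx 0 @: W.
    by rewrite BW row_in_row_span.
  by exists w.
have [f fB] := fin_all_exists rowB; pose T := \matrix_i f i.
have BT : B = row_mx 0 T.
  by apply/row_matrixP => i; rewrite row_row_mx row0 rowK fB.
exists T; first by rewrite BT row_indep_row_mx0 in B_ind.
by apply: (imset_inj row_mx0_inj); rewrite BW BT row_span_row_mx0.
Qed.

Lemma subspace_cap_Espace (t : nat) Q : subspace t (Q :&: Espace R n k) = subspace t (rslice Q).
Proof.
rewrite -(subspace_row_mx0 t); congr subspace; apply/setP => v; rewrite inE mem_Espace.
apply/andP/imsetP => [[Qv /eqP v0] | [w + ->]]; last by rewrite inE row_mxKl.
by exists (rsubmx v); rewrite ?inE -v0 hsubmxK.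
Qed.

Lemma lproj_lift (m : nat) (S : 'M[R]_(m, n)) Q :
  submodule Q -> row_span S \subset lproj Q ->
  exists X : 'M_(m, k), row_span (row_mx S X) \subset Q.
Proof.
move=> Q_sub /subsetP SQ; have lift i : exists x : 'rV_k, row_mx (row i S) x \in Q.
  have /imsetP[v Qv ->] := SQ _ (row_in_row_span S i).
  by exists (rsubmx v); rewrite hsubmxK.
have [f fQ] := fin_all_exists lift; exists (\matrix_i f i).
by apply/(row_span_subP _ Q_sub) => i; rewrite row_row_mx rowK.
Qed.

Lemma lproj_ublock (s t : nat) (S : 'M[R]_(s, n)) (X : 'M[R]_(s, k)) (T : 'M[R]_(t, k)) :
  lproj (row_span (block_mx S X 0 T)) = row_span S.
Proof. by rewrite lproj_row_span block_mxEh row_mxKl row_span_col_mx0. Qed.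

Lemma rslice_ublock (s t : nat) (S : 'M[R]_(s, n)) (X : 'M[R]_(s, k)) (T : 'M[R]_(t, k)) :
  row_indep S -> rslice (row_span (block_mx S X 0 T)) = row_span T.
Proof.
move=> /row_indepP S_ind; apply/setP => w; rewrite inE.
apply/row_spanP/row_spanP => [[c] | [c ->]]; last first.
  by exists (row_mx 0 c); rewrite mul_row_block !mul0mx mulmx0 !add0r.
rewrite -[c]hsubmxK mul_row_block mulmx0 addr0 => /eq_row_mx[/esym/S_ind -> ->].
by exists (rsubmx c); rewrite mul0mx add0r.
Qed.

Lemma submodule_eq_ublock (s t : nat) (S : 'M[R]_(s, n)) (X : 'M[R]_(s, k)) (T : 'M[R]_(t, k)) Q :
  submodule Q -> lproj Q = row_span S -> rslice Q = row_span T ->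
  row_span (row_mx S X) \subset Q -> Q = row_span (block_mx S X 0 T).
Proof.
move=> Q_sub QS QT SXQ; apply/eqP; rewrite eqEsubset; apply/andP; split; last first.
  by rewrite block_mxEv row_span_col_mx_sub // SXQ -rslice_row_span QT subxx.
apply/subsetP => v Qv; have /row_spanP[c vS] : lsubmx v \in row_span S.
  by rewrite -QS; apply: imset_f.
have /row_spanP[d vT] : rsubmx v - c *m X \in row_span T.
  rewrite -QT inE; have -> : row_mx 0 (rsubmx v - c *m X) = - 1 *: (c *m row_mx S X) + v.
    by rewrite scaleN1r mul_mx_row opp_row_mx -{2}[v]hsubmxK add_row_mx vS addNr addrC.
  have [_ QD] := submoduleP _ Q_sub; apply: QD => //.
  by apply/(subsetP SXQ)/row_spanP; exists c.
apply/row_spanP; exists (row_mx c d).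
by rewrite mul_row_block mulmx0 addr0 -vS -vT addrC subrK hsubmxK.
Qed.

Lemma ublock_basis (s t : nat) Q :
  submodule Q -> subspace s (lproj Q) -> subspace t (rslice Q) ->
  exists (S : 'M[R]_(s, n)) (X : 'M[R]_(s, k)) (T : 'M[R]_(t, k)),
    [/\ row_indep S, row_indep T & Q = row_span (block_mx S X 0 T)].
Proof.
move=> Q_sub /subspaceP[S S_ind QS] /subspaceP[T T_ind QT].
have [|X SXQ] := lproj_lift (S := S) Q_sub; first by rewrite QS.
by exists S, X, T; split=> //; apply: submodule_eq_ublock.
Qed.

Lemma subspace_lproj (s t : nat) Q :
  subspace (s + t) Q -> subspace t (rslice Q) -> subspace s (lproj Q).
Proof.
rewrite [(s + t)%N]addnC => Q_sub /subspaceP[T T_ind QT].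
have T0_ind : row_indep (row_mx (0 : 'M_(t, n)) T) by rewrite row_indep_row_mx0.
have [|D D_ind QD] := basis_extend T0_ind Q_sub; first by rewrite -rslice_row_span QT.
apply/subspaceP; exists (lsubmx D); last first.
  rewrite QD lproj_row_span -{1}[D]hsubmxK -block_mxEv block_mxEh row_mxKl.
  by rewrite row_span_col_mxC row_span_col_mx0.
apply/row_indepP => c cD; have : c *m rsubmx D \in rslice Q.
  rewrite inE QD -cD -mul_mx_row hsubmxK; apply/row_spanP; exists (row_mx 0 c).
  by rewrite mul_row_col mul0mx add0r.
rewrite QT => /row_spanP[d cdD]; have /eqP : row_mx (- d) c = 0.
  apply: (row_indepP _ D_ind); rewrite mul_row_col -[D]hsubmxK !mul_mx_row cD add_row_mx.
  by rewrite cdD mulmx0 addr0 mulNmx addNr row_mx0.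
by rewrite row_mx_eq0 => /andP[_ /eqP].
Qed.

Lemma mt_subspaceE (m t : nat) Q :
  mt_subspace m t Q =
  [&& (t <= m)%N, submodule Q, subspace (m - t) (lproj Q) & subspace t (rslice Q)].
Proof.
rewrite /mt_subspace; apply/andP/and4P => [[Q_m Q_t] | [le_tm Q_sub QS QT]].
  have le_tm := subspace_leq Q_t Q_m (subsetIl _ _).
  rewrite subspace_cap_Espace in Q_t; split=> //; first by case/andP: Q_m.
  by apply: subspace_lproj Q_t; rewrite subnK.
rewrite subspace_cap_Espace -{1}(subnK le_tm); split=> //.
have [S [X [T [S_ind T_ind ->]]]] := ublock_basis Q_sub QS QT.
exact/subspace_row_span/row_indep_ublock.
Qed.

Lemma row_span_col_ublock_sub (s1 s2 t : nat) (S1 : 'M[R]_(s1, n)) (S2 : 'M[R]_(s2, n))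
    (X1 : 'M[R]_(s1, k)) (X2 : 'M[R]_(s2, k)) (T : 'M[R]_(t, k)) Q : submodule Q ->
  (row_span (block_mx (col_mx S1 S2) (col_mx X1 X2) 0 T) \subset Q) =
  [&& row_span (row_mx S1 X1) \subset Q, row_span (row_mx S2 X2) \subset Q &
      row_span T \subset rslice Q].
Proof.
move=> Q_sub; rewrite rslice_row_span block_mxEv -block_mxEh block_mxEv.
by rewrite !row_span_col_mx_sub // andbA.
Qed.

Lemma row_span_ublock_inj (s1 s2 t r : nat) (S1 : 'M[R]_(s1, n)) (X1 : 'M[R]_(s1, k))
    (S2 : 'M[R]_(s2, n)) (T : 'M[R]_(t, k)) (D : 'M[R]_(r, k)) :
  row_indep (col_mx S1 S2) -> row_indep (col_mx T D) ->
  injective (fun Z : 'M[R]_(s2, r) =>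
    row_span (block_mx (col_mx S1 S2) (col_mx X1 (Z *m D)) 0 T)).
Proof.
move=> S_ind TD_ind Z Z' /= /eqP; rewrite eqEsubset => /andP[+ _].
rewrite row_span_col_ublock_sub ?submodule_row_span // => /and3P[_ /row_span_mulmxP[C] + _].
rewrite -[C]hsubmxK mul_row_block mulmx0 addr0 => /eq_row_mx[S2E ZE].
have lC : lsubmx C = row_mx 0 1%:M.
  by apply: (row_indep_mulmx_inj S_ind); rewrite mul_row_col mul0mx add0r mul1mx.
have /eq_row_mx[_] // : row_mx 0 Z = row_mx (rsubmx C) Z'.
apply: (row_indep_mulmx_inj TD_ind); rewrite !mul_row_col mul0mx add0r ZE lC.
by rewrite mul_row_col mul0mx add0r mul1mx addrC.
Qed.

(* Once the rows of [T] are completed by those of [D] to a basis of [R^k], each such [Q] has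
   exactly one basis of the form [block_mx (col_mx S1 S2) (col_mx X1 (Z *m D)) 0 T]. *)
Lemma card_submodules_lproj_rslice (s1 s2 t : nat) (S1 : 'M[R]_(s1, n)) (X1 : 'M[R]_(s1, k))
    (S2 : 'M[R]_(s2, n)) (T : 'M[R]_(t, k)) :
  row_indep (col_mx S1 S2) -> row_indep T ->
  #|[set Q | [&& submodule Q, row_span (row_mx S1 X1) \subset Q,
              lproj Q == row_span (col_mx S1 S2) & rslice Q == row_span T]]| =
  (#|R| ^ (s2 * (k - t)))%N.
Proof.
move=> S_ind T_ind; have [||D TD_ind TD_span] := @basis_extend R t (k - t) k T setT T_ind.
- by rewrite subnKC ?subspaceT // (row_indep_leq T_ind).
- exact: subsetT.
have <- : #|[set: 'M[R]_(s2, k - t)]| = (#|R| ^ (s2 * (k - t)))%N by rewrite cardsT card_mx.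
rewrite -(card_imset _ (row_span_ublock_inj (X1 := X1) S_ind TD_ind)); apply: eq_card => Q.
rewrite inE; apply/and4P/imsetP => [[Q_sub PQ /eqP QS /eqP QT] | [Z _ ->]]; last first.
  rewrite submodule_row_span lproj_ublock rslice_ublock // !eqxx; split=> //.
  rewrite block_mxEv -block_mxEh block_mxEv.
  exact: subset_trans (row_span_sub_col_mxl _ _) (row_span_sub_col_mxl _ _).
have [|X2 S2Q] := lproj_lift (S := S2) Q_sub; first by rewrite QS row_span_sub_col_mxr.
have /row_span_mulmxP[C X2E] : row_span X2 \subset row_span (col_mx T D).
  by rewrite -TD_span subsetT.
exists (rsubmx C) => //; apply: submodule_eq_ublock => //.
rewrite -block_mxEh block_mxEv row_span_col_mx_sub // PQ /=.
apply: (@subset_trans _ _ (row_span (col_mx (row_mx S2 X2) (row_mx 0 T)))); last first.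
  by rewrite row_span_col_mx_sub // S2Q -rslice_row_span QT subxx.
apply/row_span_mulmxP; exists (row_mx 1%:M (- lsubmx C)).
rewrite mul_row_col mul1mx mul_mx_row mulmx0 add_row_mx addr0 X2E -{2}[C]hsubmxK.
by rewrite mul_row_col mulNmx addrAC subrr add0r.
Qed.

Lemma card_mt_subspaces_above (m1 t1 m t : nat) P : mt_subspace m1 t1 P -> (t <= m)%N ->
  #|mt_subspaces_above m t P| =
  (#|subspaces_above (m - t) (lproj P)| * #|subspaces_above t (rslice P)| *
   #|R| ^ ((k - t) * ((m - t) - (m1 - t1))))%N.
Proof.
rewrite mt_subspaceE => /and4P[_ P_sub PS PT] le_tm.
move: (m1 - t1)%N PS => s1 PS.
have [S1 [X1 [T1 [S1_ind T1_ind PE]]]] := ublock_basis P_sub PS PT.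
rewrite -cardsX.
apply: (card_constant_fibres (f := fun Q => (lproj Q, rslice Q))) => [Q | [S' T']].
  rewrite inE mt_subspaceE => /andP[/and4P[_ _ QS QT] sPQ].
  by rewrite !inE QS QT lprojS ?rsliceS.
rewrite !inE /= => /andP[/andP[S'_sub sPS'] /andP[T'_sub sPT']].
have sPQE Q : submodule Q ->
    (P \subset Q) = (row_span (row_mx S1 X1) \subset Q) && (rslice P \subset rslice Q).
  by move=> Q_sub; rewrite PE rslice_ublock // block_mxEv row_span_col_mx_sub // rslice_row_span.
have [S2 S_ind S'E] : exists2 S2 : 'M_(m - t - s1, n), row_indep (col_mx S1 S2) &
    S' = row_span (col_mx S1 S2).
  apply: basis_extend S1_ind _ _; last by rewrite PE lproj_ublock in sPS'.
  by rewrite subnKC // (subspace_leq PS S'_sub).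
have /subspaceP[T T_ind T'E] := T'_sub.
rewrite mulnC -(card_submodules_lproj_rslice X1 S_ind T_ind); apply: eq_card => Q.
rewrite !inE mt_subspaceE xpair_eqE le_tm -S'E -T'E /=.
apply/andP/and4P => [[/andP[/and3P[Q_sub _ _] +] /andP[QS QT]] | [Q_sub S1Q QS QT]].
  by rewrite sPQE // => /andP[].
by rewrite sPQE // S1Q Q_sub (eqP QS) (eqP QT) S'_sub T'_sub sPT' !eqxx.
Qed.

Lemma mt_subspaces_above_neq0 (m1 t1 m t : nat) P : mt_subspace m1 t1 P ->
  (mt_subspaces_above m t P != set0) =
  [&& (t <= m)%N, (t1 <= t <= k)%N & (m1 - t1 <= m - t <= n)%N].
Proof.
move=> P_mt; have := P_mt; rewrite mt_subspaceE => /and4P[_ _ PS PT].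
have R_gt0 : (0 < #|R|)%N by rewrite ltnW ?card_finNzRing_gt1.
have [le_tm | lt_mt] := leqP t m; last first.
  apply/set0Pn => -[Q]; rewrite inE mt_subspaceE => /andP[/and4P[le_tm _ _ _] _].
  by rewrite leqNgt lt_mt in le_tm.
rewrite -card_gt0 (card_mt_subspaces_above P_mt) // !muln_gt0 expn_gt0 R_gt0 andbT !card_gt0.
by rewrite (subspaces_above_neq0 _ PS) (subspaces_above_neq0 _ PT) andbC.
Qed.

End Slices.

Lemma card_rows_in (T : finType) (M : {set T}) (n : nat) :
  #|[set v : 'rV[T]_n | [forall i, v 0 i \in M]]| = (#|M| ^ n)%N.
Proof.
pose f (v : 'rV[T]_n) : {ffun 'I_n -> T} := [ffun i => v 0 i].
have f_bij : bijective f.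
  exists (fun g : {ffun 'I_n -> T} => \row_i g i) => [v | g].
    by apply/rowP => i; rewrite mxE ffunE.
  by apply/ffunP => i; rewrite ffunE mxE.
rewrite -[n in RHS]card_ord -card_ffun_on -cardsE -(on_card_preimset (onW_bij _ f_bij)).
apply: eq_card => v; rewrite !inE.
by apply/forallP/ffun_onP => vM i; have := vM i; rewrite ffunE.
Qed.

Section LocalRing.
Variables (A : finComNzRingType) (M : {set A}).
Hypothesis M_local : local_ring_with M.

Lemma proper_ideal_sub_local (I : {set A}) : idealr_closed I -> I \subset M.
Proof.
pose idb (J : {set A}) := [&& 0 \in J, 1 \notin J &
  [forall a, forall u in J, forall v in J, a * u + v \in J]].
have idP (J : {set A}) : reflect (idealr_closed J) (idb J).
  apply: (iffP and3P) => -[J0 J1 JM]; split=> //.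
    move=> a u v Ju Jv; move/forallP/(_ a)/forall_inP/(_ u Ju): JM.
    by move/forall_inP; apply.
  by apply/forallP => a; apply/forall_inP => u Ju; apply/forall_inP => v; apply: JM.
move=> /idP/maxset_exists[J /maxsetP[/idP J_id J_max] sIJ].
suff <- : J = M by [].
by apply: M_local.2; split=> // K /idP K_id sJK; apply: J_max.
Qed.

Lemma notin_local_regular (x r : A) : x \notin M -> r * x = 0 -> r = 0.
Proof.
move=> xM rx; apply/eqP; apply: contraNT xM => r_neq0.
have: [set x * y | y : A] \subset M.
  apply: proper_ideal_sub_local; split.
  - by apply/imsetP; exists 0; rewrite ?mulr0.
  - apply/imsetP => -[y _ xy]; case/eqP: r_neq0.
    by rewrite -[r]mulr1 xy mulrA rx mul0r.
  - move=> a _ _ /imsetP[y _ ->] /imsetP[z _ ->].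
    by rewrite mulrCA -mulrDr; apply: imset_f.
by move/subsetP; apply; apply/imsetP; exists 1; rewrite ?mulr1.
Qed.

Lemma row_indep_local (n : nat) (v : 'rV[A]_n) :
  row_indep v = ~~ [forall i, v 0 i \in M].
Proof.
have [[[M0 /negP M1 MD] _] _] := M_local; apply/idP/forallPn => [|[i vi]].
  rewrite row_indep_unimodular => /unimodularP[b /matrixP/(_ 0 0)].
  rewrite !mxE => vb; apply/existsP; rewrite -negb_forall; apply/negP => /forallP vM; case: M1.
  rewrite -[1]vb; apply: (big_ind (fun x => x \in M)) => // [x y Mx My | i _].
    by rewrite -[x]mul1r MD.
  by rewrite mulrC -[_ * _]addr0 MD.
apply/row_indepP => c cv; rewrite [c]mx11_scalar.
suff -> : c 0 0 = 0 by rewrite raddf0.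
apply: (notin_local_regular vi); have /rowP/(_ i) := cv.
by rewrite [c]mx11_scalar mul_scalar_mx !mxE.
Qed.

Lemma num_indep_local_row (n : nat) :
  (num_indep A 1 n)%:R = #|A|%:R ^+ n - #|M|%:R ^+ n :> rat.
Proof.
apply/eqP; rewrite eq_sym subr_eq -!natrX -natrD eqr_nat -card_rows_in addnC.
have -> : (#|A| ^ n)%N = #|{: 'rV[A]_n}| by rewrite card_mx mul1n.
rewrite -(cardsC [set v : 'rV[A]_n | [forall i, v 0 i \in M]]) eqn_add2l.
by apply/eqP/eq_card => v; rewrite !inE row_indep_local.
Qed.

End LocalRing.

Section DirectProduct.
Variables (R : finComNzRingType) (l : nat) (Rj : 'I_l -> finComNzRingType).
Variables (M : forall j, {set Rj j}) (pr : forall j, {rmorphism R -> Rj j}).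
Hypothesis M_local : forall j, local_ring_with (M j).
Hypothesis pr_prod : is_direct_product pr.

Lemma pr_joint_inj (r r' : R) : (forall j, pr j r = pr j r') -> r = r'.
Proof.
move=> rr'; have [s [_ uniq_s]] := pr_prod (fun j => pr j r').
by rewrite -(uniq_s r rr'); apply: uniq_s.
Qed.

Lemma map_mx_pr_joint_inj (m n : nat) (A B : 'M[R]_(m, n)) :
  (forall j, map_mx (pr j) A = map_mx (pr j) B) -> A = B.
Proof.
move=> AB; apply/matrixP => i i'; apply: pr_joint_inj => j.
by have /matrixP/(_ i i') := AB j; rewrite !mxE.
Qed.

Lemma map_mx_pr_joint_surj (m n : nat) (B : forall j, 'M[Rj j]_(m, n)) :
  exists A : 'M[R]_(m, n), forall j, map_mx (pr j) A = B j.
Proof.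
have lift (i : 'I_m * 'I_n) : exists r, forall j, pr j r = B j i.1 i.2.
  by have [r [rB _]] := pr_prod (fun j => B j i.1 i.2); exists r.
have [f fB] := fin_all_exists lift; exists (\matrix_(i, i') f (i, i')) => j.
by apply/matrixP => i i'; rewrite !mxE fB.
Qed.

Lemma row_indep_prod (m n : nat) (A : 'M[R]_(m, n)) :
  row_indep A = [forall j, row_indep (map_mx (pr j) A)].
Proof.
apply/idP/forallP => [|A_ind].
  rewrite row_indep_unimodular => /unimodularP[B AB] j.
  apply/unimodular_row_indep/unimodularP; exists (map_mx (pr j) B).
  by rewrite -map_mxM AB map_mx1.
apply/row_indepP => c cA; apply: map_mx_pr_joint_inj => j; rewrite map_mx0.
by apply: (row_indepP _ (A_ind j)); rewrite -map_mxM cA map_mx0.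
Qed.

Lemma num_indep_prod (m n : nat) :
  num_indep R m n = (\prod_(j < l) num_indep (Rj j) m n)%N.
Proof.
rewrite /num_indep -cardsXn.
pose f (A : 'M[R]_(m, n)) : {dffun forall j : 'I_l, 'M[Rj j]_(m, n)} :=
  [ffun j => map_mx (pr j) A].
have f_inj : injective f.
  by move=> A B /ffunP AB; apply: map_mx_pr_joint_inj => j; have := AB j; rewrite !ffunE.
rewrite -(card_imset _ f_inj); apply: eq_card => g.
have [A gA] := map_mx_pr_joint_surj g; have <- : f A = g by apply/ffunP => j; rewrite ffunE gA.
rewrite mem_imset // inE row_indep_prod.
by apply/forallP/setXnP => A_ind j; have := A_ind j; rewrite inE ffunE.
Qed.

Lemma NR_num_indep (a b : nat) : NR M a b = (num_indep R a b)%:R / (num_indep R a a)%:R.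
Proof.
rewrite !num_indep_prod !natr_prod -prodf_div; apply: eq_bigr => j _.
rewrite !num_indepE !natr_prod -prodf_div; apply: eq_bigr => i _.
rewrite !natrM -mulf_div divff ?mul1r ?(num_indep_local_row (M_local j)) //.
by rewrite pnatr_eq0 -lt0n expn_gt0 ltnW ?card_finNzRing_gt1.
Qed.

Lemma card_subspaces_above_NR (m p n : nat) (P : {set 'rV[R]_n}) :
  subspace m P -> #|subspaces_above (m + p) P|%:R = NR M p (n - m).
Proof.
move=> P_sub; rewrite NR_num_indep -(card_subspaces_above _ P_sub) natrM mulfK //.
by rewrite pnatr_eq0 -lt0n num_indep_gt0.
Qed.

Lemma card_subspaces_NR (a b : nat) :
  #|[set Q : {set 'rV[R]_b} | subspace a Q]|%:R = NR M a b.
Proof.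
rewrite -[b in RHS]subn0 -(card_subspaces_above_NR a (subspace0 R b)); congr _%:R.
apply: eq_card => Q; rewrite !inE add0n sub1set.
by have [/andP[/submoduleP[]] |] := boolP (subspace a Q).
Qed.

Lemma card_mt_subspaces_above_NR (n k m1 t1 m t : nat) (P : {set 'rV[R]_(n + k)}) :
  mt_subspace m1 t1 P -> mt_subspaces_above m t P != set0 ->
  #|mt_subspaces_above m t P|%:R =
  #|R|%:R ^+ ((k - t) * ((m - t) - (m1 - t1))) * NR M ((m - t) - (m1 - t1)) (n - (m1 - t1)) *
  NR M (t - t1) (k - t1).
Proof.
move=> P_mt; rewrite (mt_subspaces_above_neq0 _ _ P_mt).
case/and3P => le_tm /andP[le_t1t _] /andP[le_s1s _].
have := P_mt; rewrite mt_subspaceE => /and4P[_ _ PS PT].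
rewrite (card_mt_subspaces_above P_mt le_tm) !natrM natrX mulrC mulrA.
rewrite -(card_subspaces_above_NR _ PS) -(card_subspaces_above_NR _ PT).
by rewrite (subnKC le_s1s) (subnKC le_t1t).
Qed.

End DirectProduct.

Theorem theorem5p3 (R : finComNzRingType) (l : nat)
    (Rj : 'I_l -> finComNzRingType) (M : forall j, {set Rj j})
    (pr : forall j, {rmorphism R -> Rj j})
    (hlocal : forall j, local_ring_with (M j))
    (hprod : is_direct_product pr)
    (n k m1 t1 m t : nat) (P : {set 'rV[R]_(n + k)})
    (hP : mt_subspace m1 t1 P) :
  [/\ (mt_subspaces_above m t P != set0) <->
        ((0 <= t1%:Z /\ t1%:Z <= t%:Z /\ t%:Z <= k%:Z) /\
         (0 <= m1%:Z - t1%:Z /\ m1%:Z - t1%:Z <= m%:Z - t%:Z /\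
          m%:Z - t%:Z <= n%:Z)),
      mt_subspaces_above m t P != set0 ->
        (forall P' : {set 'rV[R]_(n + k)}, mt_subspace m1 t1 P' ->
           #|mt_subspaces_above m t P'| = #|mt_subspaces_above m t P|) /\
        #|mt_subspaces_above m t P|%:R =
          #|R|%:R ^+ ((k - t) * ((m - t) - (m1 - t1)))
          * NR M ((m - t) - (m1 - t1)) (n - (m1 - t1))
          * NR M (t - t1) (k - t1)
    & forall a b : nat,
        #|[set Q : {set 'rV[R]_b} | subspace a Q]|%:R = NR M a b].
Proof.
have countE := card_mt_subspaces_above_NR hlocal hprod.
split=> [|P_neq0|a b]; last exact: card_subspaces_NR hlocal hprod a b.
  have := hP; rewrite mt_subspaceE => /andP[le_t1m1 _].
  by rewrite (mt_subspaces_above_neq0 _ _ hP); split; lia.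
split=> [P' hP'|]; last exact: countE.
apply/eqP; rewrite -(eqr_nat rat) !(countE _ _ m1 t1) //.
by rewrite (mt_subspaces_above_neq0 _ _ hP') -(mt_subspaces_above_neq0 _ _ hP).
Qed.
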